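(* Let $F$ be a free filter on $\omega$. The following are equivalent: (1) $F$ does not have the Nikodym property; (2) there is a density submeasure $\varphi$ on $\omega$ such that $\varphi(\omega)=\infty$ and $F\subseteq\mathrm{Exh}(\varphi)^*$; (3) there is a non-pathological lower semicontinuous submeasure $\varphi$ on $\omega$ such that $\varphi(\omega)=\infty$ and $F\subseteq\mathrm{Exh}(\varphi)^*$.
   Context: A filter on $\omega$ is free if it contains all cofinite sets. For a free filter $F$, $N_F=\omega\cup\{p_F\}$ has every $n\in\omega$ isolated and neighbourhoods of $p_F$ of the form $A\cup\{p_F\}$, $A\in F$. Finitely supported measures are $\sum_{i=1}^k\alpha_i\delta_{x_i}$ with norm $\sum|\alpha_i|$. $F$ has the Nikodym property if there is no sequence $\langle\mu_n\rangle$ of finitely supported measures on $N_F$ with $\|\mu_n\|\to\infty$ and $\mu_n(A)\to 0$ for every clopen $A\subseteq N_F$. A submeasure is $\varphi\colon\mathcal P(\omega)\to[0,\infty]$ with $\varphi(\emptyset)=0$, $\varphi(\{n\})<\infty$, monotone and subadditive; it is lower semicontinuous (lsc) if $\varphi(A)=\lim_n\varphi(A\cap[0,n])$ for all $A$. $\mathrm{Exh}(\varphi)=\{A\subseteq\omega:\lim_n\varphi(A\setminus[0,n])=0\}$. $\varphi$ is non-pathological if $\varphi(A)=\sup\{\mu(A):\mu$ a non-negative measure on $\omega$ with $\mu\le\varphi\}$ for all $A$. $\varphi$ is a density submeasure if $\varphi=\sup_n\mu_n$ for a sequence of finitely supported non-negative measures on $\omega$ with pairwise disjoint supports. For a family $S\subseteq\mathcal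 P(\omega)$, $S^*=\{\omega\setminus X: X\in S\}$. *)

(* Defs.v *)
From HB Require Import structures.
From mathcomp Require Import all_boot all_order all_algebra finmap.
From mathcomp Require Import all_classical all_reals all_analysis.

Set Implicit Arguments.
Unset Strict Implicit.
Unset Printing Implicit Defensive.

Import Order.TTheory GRing.Theory Num.Theory.
Import numFieldNormedType.Exports.

Local Open Scope classical_set_scope.
Local Open Scope ring_scope.

(* Filters are proper: F : pfilter_on nat carries ~ F set0. *)
Definition free_filter (F : pfilter_on nat) : Prop :=
  forall A : set nat, finite_set (~` A) -> pfilter F A.

(* The space N_F: [Some n] is the point n of omega and [None] is p_F. *)
Definition NF (F : pfilter_on nat) : Type := option nat.

HB.instance Definition _ (F : pfilter_on nat) := Choice.on (NF F).

Section NF_topology.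
Variable F : pfilter_on nat.

Definition NF_nbhs (x : NF F) : set_system (NF F) :=
  if x is Some n then principal_filter (Some n : NF F)
  else [set (Some @` A `|` [set None] : set (NF F)) | A in pfilter F].

Lemma NF_nbhs_None (U : set (NF F)) :
  NF_nbhs None U <-> U None /\ pfilter F (Some @^-1` U).
Proof.
split=> [[A FA <-]|[U0 FU]].
  split; first by right.
  by apply: filterS FA => n An; left; exists n.
exists (Some @^-1` U) => //; apply/seteqP; split=> [_ [[n ? <-]//|->//]|].
by case=> [n Un|_]; [left; exists n|right].
Qed.

Lemma NF_nbhs_filter (x : NF F) : ProperFilter (NF_nbhs x).
Proof.
case: x => [n|]; first exact: principal_filter_proper.
split; first by move/NF_nbhs_None => [].
split.
- by apply/NF_nbhs_None; split=> //; exact: filterT.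
- move=> U V /NF_nbhs_None[U0 FU] /NF_nbhs_None[V0 FV].
  by apply/NF_nbhs_None; split=> //; exact: filterI FU FV.
- move=> U V UV /NF_nbhs_None[U0 FU].
  apply/NF_nbhs_None; split; first exact: UV.
  by apply: filterS FU => n; exact: UV.
Qed.

Lemma NF_nbhs_singleton (x : NF F) (U : set (NF F)) : NF_nbhs x U -> U x.
Proof.
by case: x => [n /principal_filterP|/NF_nbhs_None[]].
Qed.

Lemma NF_nbhs_nbhs (x : NF F) (U : set (NF F)) :
  NF_nbhs x U -> NF_nbhs x (NF_nbhs^~ U).
Proof.
case: x => [n /principal_filterP Un|NU].
  by apply/principal_filterP; apply/principal_filterP.
apply/NF_nbhs_None; split=> //.
have /NF_nbhs_None[_ FU] := NU.
by apply: filterS FU => n Un; apply/principal_filterP.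
Qed.

HB.instance Definition _ := hasNbhs.Build (NF F) NF_nbhs.
HB.instance Definition _ := Nbhs_isNbhsTopological.Build (NF F)
  NF_nbhs_filter NF_nbhs_singleton NF_nbhs_nbhs.

End NF_topology.

(* The finitely supported measure \sum_i alpha_i \delta_(x_i), with distinct
   points x_i, is encoded by the map sending x_i to alpha_i and every other
   point to 0. *)
Definition fsmeasure (R : realType) (T : choiceType) :=
  {fsfun T -> R with 0}.

Definition fsmeas (R : realType) (T : choiceType) (mu : fsmeasure R T)
    (A : set T) : R :=
  \sum_(x <- finsupp mu | x \in A) mu x.

Definition fsnorm (R : realType) (T : choiceType) (mu : fsmeasure R T) : R :=
  \sum_(x <- finsupp mu) `|mu x|.

Definition nikodym_property (R : realType) (F : pfilter_on nat) : Prop :=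
  ~ exists mu : nat -> fsmeasure R (NF F),
      (fsnorm (mu n) @[n --> \oo] --> +oo) /\
      (forall A : set (NF F), clopen A ->
         fsmeas (mu n) A @[n --> \oo] --> (0 : R)).

Section submeasures.
Context {R : realType}.
Implicit Types phi : set nat -> \bar R.
Local Open Scope ereal_scope.

Definition submeasure phi : Prop :=
  [/\ forall A, 0 <= phi A,
      phi set0 = 0,
      forall n, phi [set n] < +oo,
      forall A B, A `<=` B -> phi A <= phi B &
      forall A B, phi (A `|` B) <= phi A + phi B].

(* `I_n.+1 is the interval [0, n]. *)
Definition lsc_submeasure phi : Prop :=
  forall A, phi (A `&` `I_n.+1) @[n --> \oo] --> phi A.

Definition Exh phi : set_system nat :=
  [set A | phi (A `\` `I_n.+1) @[n --> \oo] --> 0].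

(* The measures in the supremum are countably additive on all subsets of nat
   and may take the value +oo. *)
Definition nonpathological phi : Prop :=
  forall A, phi A =
    ereal_sup [set mu A | mu in [set mu : {measure set nat -> \bar R} |
                                 forall B, mu B <= phi B]].

Definition density_submeasure phi : Prop :=
  submeasure phi /\
  exists mu : nat -> fsmeasure R nat,
    [/\ forall n k, (0 <= mu n k)%R,
        forall n m, n != m -> [disjoint finsupp (mu n) & finsupp (mu m)]%fset &
        forall A, phi A = ereal_sup [set (fsmeas (mu n) A)%:E | n in setT]].

End submeasures.

Definition dual_family (S : set_system nat) : set_system nat :=
  [set ~` X | X in S].

(* Main.v *)
(* For A in F every subset of the complement of A is clopen in N_F, so if
   mu_n(C) -> 0 for all clopen C, a gliding hump argument (Schur) shows that the
   variation of mu_n on the complement of A tends to 0, while mu_n(N_F) -> 0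
   forces the mass of |mu_n| on omega to infinity. Along a subsequence, the
   variations |mu_n| cut off to disjoint finite blocks define the density
   submeasure. Conversely, if phi is non-pathological and lsc with
   phi(omega) = oo, then beyond each n there is a finitely supported measure of
   mass at least n below phi; subtracting its mass at p_F gives a sequence
   that refutes the Nikodym property. *)
Require Import Defs.
From mathcomp Require Import all_boot all_order all_algebra finmap.
From mathcomp Require Import all_classical all_reals all_analysis.
From mathcomp Require Import lra zify.

Set Implicit Arguments.
Unset Strict Implicit.
Unset Printing Implicit Defensive.

Import Order.TTheory GRing.Theory Num.Theory.
Import numFieldNormedType.Exports.

Local Open Scope classical_set_scope.
Local Open Scope ring_scope.

(** * Finitely supported signed measures and their variation *)

Section finitely_supported_measures.
Variables (R : realType) (T : choiceType).
Implicit Types (mu : fsmeasure R T) (A B : set T) (D : {fset T}).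

Lemma fsmeas_sum mu D A : (finsupp mu `<=` D)%fset ->
  fsmeas mu A = \sum_(x <- D | x \in A) mu x.
Proof.
move=> sD; rewrite /fsmeas big_mkcond [RHS]big_mkcond.
apply: big_fset_incl => // x _ /fsfun_dflt ->; exact: if_same.
Qed.

Lemma fsmeas_fsfun D (f : T -> R) A :
  fsmeas [fsfun x in D => f x] A = \sum_(x <- D | x \in A) f x.
Proof.
rewrite (fsmeas_sum _ (finsupp_sub _ _ _)) big_seq_cond [RHS]big_seq_cond.
by apply: eq_bigr => x /andP[xD _]; rewrite fsfunE xD.
Qed.

Lemma fsmeas_fset mu D : fsmeas mu [set` D] = \sum_(x <- D) mu x.
Proof.
rewrite (@fsmeas_sum _ (finsupp mu `|` D)%fset) ?fsubsetUl// big_mkcond.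
rewrite -(big_fset_incl _ (fsubsetUr (finsupp mu) D)) => [|x _ /negbTE xD].
  by rewrite big_seq [RHS]big_seq; apply: eq_bigr => x xD; rewrite mem_setE xD.
by rewrite mem_setE xD.
Qed.

Lemma eq_fsmeas mu A B : (forall x, x \in finsupp mu -> A x <-> B x) ->
  fsmeas mu A = fsmeas mu B.
Proof.
move=> AB; rewrite /fsmeas big_seq_cond [RHS]big_seq_cond.
apply: eq_bigl => x; case: (boolP (x \in _)) => //= /AB ABx.
by apply/idP/idP; rewrite !inE => /ABx.
Qed.

Lemma fsmeas_set1 mu x : fsmeas mu [set x] = mu x.
Proof. by rewrite -set_fset1 fsmeas_fset big_seq_fset1. Qed.

Lemma fsmeasID mu A B :
  fsmeas mu A = fsmeas mu (A `&` B) + fsmeas mu (A `\` B).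
Proof.
rewrite /fsmeas (bigID (fun x => x \in B)) /=; congr (_ + _).
  by apply: eq_bigl => x; rewrite in_setI.
by apply: eq_bigl => x; rewrite in_setD.
Qed.

Lemma fsmeas_ge0 mu A : (forall x, 0 <= mu x) -> 0 <= fsmeas mu A.
Proof. by move=> mu0; apply: sumr_ge0. Qed.

Lemma le_fsmeas mu A B : (forall x, 0 <= mu x) -> A `<=` B ->
  fsmeas mu A <= fsmeas mu B.
Proof.
move=> mu0 AB; rewrite (fsmeasID _ B A) setIidr // lerDl; exact: fsmeas_ge0.
Qed.

Definition fsabs mu : fsmeasure R T := [fsfun x in finsupp mu => `|mu x|].

Lemma fsabsE mu x : fsabs mu x = `|mu x|.
Proof. by rewrite fsfunE; case: finsuppP; rewrite ?normr0. Qed.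

Lemma fsabs_ge0 mu x : 0 <= fsabs mu x.
Proof. by rewrite fsabsE. Qed.
Hint Resolve fsabs_ge0 : core.

Lemma finsupp_fsabs mu : finsupp (fsabs mu) = finsupp mu.
Proof. by apply/fsetP => x; rewrite !mem_finsupp fsabsE normr_eq0. Qed.

Lemma fsmeas_fsabs mu A :
  fsmeas (fsabs mu) A = \sum_(x <- finsupp mu | x \in A) `|mu x|.
Proof. exact: fsmeas_fsfun. Qed.

Lemma fsnormE mu : fsnorm mu = fsmeas (fsabs mu) setT.
Proof.
by rewrite fsmeas_fsabs /fsnorm; apply: eq_bigl => x; rewrite in_setT.
Qed.

Lemma ler_norm_fsmeas mu A : `|fsmeas mu A| <= fsmeas (fsabs mu) A.
Proof. by rewrite fsmeas_fsabs; exact: ler_norm_sum. Qed.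

(** The variation of A splits into the mass of its non-negative part and minus the mass of its
    negative part; the larger of the two absolute values is at least half the sum. This turns a
    large variation into a single set of large signed mass. *)
Lemma fsabs_half mu A :
  exists2 B, B `<=` A & fsmeas (fsabs mu) A <= 2 * `|fsmeas mu B|.
Proof.
pose P := A `&` [set x | 0 <= mu x]; pose N := A `\` [set x | 0 <= mu x].
have : fsmeas (fsabs mu) A = fsmeas mu P - fsmeas mu N.
  rewrite (fsmeasID _ A [set x | 0 <= mu x]) -/P -/N !fsmeas_fsabs /fsmeas -sumrN.
  congr (_ + _); apply: eq_bigr => x.
    by rewrite inE => -[_ /= mu0]; rewrite ger0_norm.
  by rewrite inE => -[_ /= /negP]; rewrite -ltNge => mu0; rewrite ltr0_norm.
have := ler_norm (fsmeas mu P); have := ler_norm (- fsmeas mu N); rewrite normrN.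
have [PN|NP] := leP `|fsmeas mu N| `|fsmeas mu P| => hN hP ->.
  by exists P; [exact: subIsetl | lra].
by exists N; [exact: subDsetl | lra].
Qed.

End finitely_supported_measures.
#[global] Hint Resolve fsabs_ge0 : core.

(** * The gliding hump argument *)

Section gliding_hump.

Lemma fset_chain (T : choiceType) (X : Type) (supp : X -> {fset T})
    (Q : nat -> {fset T} -> X -> Prop) :
  (forall i S, exists x, Q i S x) ->
  exists S x, forall i, Q i (S i) (x i) /\ S i.+1 = (S i `|` supp (x i))%fset.
Proof.
move=> exQ; have [g gQ] := choice (fun p : nat * {fset T} => exQ p.1 p.2).
pose fix S i := if i is j.+1 then (S j `|` supp (g (j, S j)))%fset else fset0.
by exists S, (fun i => g (i, S i)) => i; split; first exact: gQ (i, S i).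
Qed.

Lemma fset_chain_sub (T : choiceType) (S : nat -> {fset T}) i j :
  (forall i, S i `<=` S i.+1)%fset -> (i <= j)%N -> (S i `<=` S j)%fset.
Proof.
by move=> Si; apply: (@homo_leq _ S (fun A B => A `<=` B)%fset) => // x y z /fsubset_trans; apply.
Qed.

Variables (R : realType) (T : choiceType).

Implicit Type mu : nat -> fsmeasure R T.

Lemma cvg_fsabs_fset mu (S : {fset T}) :
  (forall x, x \in S -> mu n x @[n --> \oo] --> (0 : R)) ->
  fsmeas (fsabs (mu n)) [set` S] @[n --> \oo] --> (0 : R).
Proof.
move=> mu0.
suff : (\sum_(x <- S | x \in S) fsabs (mu n) x) @[n --> \oo] -->
    \sum_(x <- S | x \in S) (0 : R).
  by rewrite big1//; under eq_fun do rewrite -big_seq -fsmeas_fset.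
apply: cvg_big => [|x xS]; first exact: add_continuous.
under eq_fun do rewrite fsabsE.
by apply/norm_cvg0P; exact: mu0.
Qed.

(* Since each measure has finite support, no a priori bound on the norms is
   required: each hump P_i lives off the supports of all the earlier measures,
   and all the later humps live off the support of the i-th measure. *)
Lemma schur mu (C : set T) :
  (forall B, B `<=` C -> fsmeas (mu n) B @[n --> \oo] --> (0 : R)) ->
  fsmeas (fsabs (mu n)) C @[n --> \oo] --> (0 : R).
Proof.
move=> mu0; apply: contrapT => ncvg.
have [e e0 large] : exists2 e, 0 < e &
    forall N, exists2 n, (N <= n)%N & e < fsmeas (fsabs (mu n)) C.
  apply: contrapT => nlarge; apply: ncvg; apply/cvgr0Pnorm_le => e e0.
  apply: contrapT => nnear; apply: nlarge; exists e => // N.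
  apply: contrapT => nn; apply: nnear; exists N => // n /= Nn.
  rewrite ger0_norm ?fsmeas_ge0// leNgt; apply/negP => en.
  by apply: nn; exists n.
(* Singletons inside C give pointwise convergence at the points of C, so on the finite set of points
   of S in C the variation tends to 0. *)
have small (S : {fset T}) : \forall n \near \oo,
    fsmeas (fsabs (mu n)) (C `&` [set` S]) < e / 8.
  have e8 : 0 < e / 8 by rewrite divr_gt0.
  have : fsmeas (fsabs (mu n)) [set` [fset x in S | x \in C]%fset]
           @[n --> \oo] --> (0 : R).
    apply: cvg_fsabs_fset => x; rewrite !inE /= => /andP[_ xC].
    under eq_fun do rewrite -fsmeas_set1.
    by apply: mu0 => _ ->; exact: set_mem.
  move/cvgr0_norm_lt => /(_ _ e8); apply: filterS => n.
  rewrite ger0_norm ?fsmeas_ge0//; apply: le_lt_trans.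
  apply: le_fsmeas => // x [Cx Sx] /=.
  by rewrite !inE /= mem_set// andbT.
(* A stage is a pair of an index and a hump. The variation on C exceeds e and less than e / 8 of it
   lies in S, so at least 7 / 8 * e remains off S; the hump captures half of that. *)
have [|S [h hP]] := @fset_chain T (nat * set T)%type (fun p => finsupp (mu p.1))
  (fun i S p => [/\ (i <= p.1)%N, p.2 `<=` (C `&` [set` finsupp (mu p.1)]) `\` [set` S],
     fsmeas (fsabs (mu p.1)) (C `&` [set` S]) < e / 8 &
     7 / 8 * e <= 2 * `|fsmeas (mu p.1) p.2|]).
  move=> i S; have [N _ SN] := small S.
  have [n + en] := large (maxn i N); rewrite geq_max => /andP[ni /SN/= sn].
  have [P PC hP] := fsabs_half (mu n) ((C `&` [set` finsupp (mu n)]) `\` [set` S]).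
  exists (n, P); split => //=; apply: le_trans hP.
  rewrite (@eq_fsmeas _ _ _ _ (C `\` [set` S])) => [|x]; last first.
    by rewrite finsupp_fsabs => xmu; split => [[[]]|[]].
  by have := fsmeasID (fsabs (mu n)) C [set` S]; lra.
have Ssub i : (S i `<=` S i.+1)%fset by rewrite (hP i).2 fsubsetUl.
pose B := \bigcup_i (h i).2.
have BC : B `<=` C.
  by move=> x [i _]; have [[_ + _ _] _] := hP i => /[apply] -[[]].
(* At stage N the hump contributes at least 7 / 16 * e in absolute value and the part of B in [S N]
   less than e / 8. The measure of B is then above 5 / 16 * e, against the bound e / 4. *)
have /cvgr0_norm_lt/(_ (e / 4)) := mu0 B BC.
rewrite divr_gt0// => /(_ isT)[N _ /(_ (h N).1)] /=.
have [[Nh hC hS hm] _] := hP N => /(_ Nh).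
rewrite (fsmeasID _ B [set` S N]) addrC.
have -> : fsmeas (mu (h N).1) (B `\` [set` S N]) = fsmeas (mu (h N).1) (h N).2.
  apply: eq_fsmeas => x xN; split => [[[j _ hjx] xS]|hNx]; last first.
    by split; [exists N | exact: (hC _ hNx).2].
  (* An earlier hump lies inside [S N], and a later one avoids the support of the N-th measure, so
     only the N-th hump can contain x. *)
  have [[_ hjC _ _] Sj] := hP j; have [[_ xj] xSj] := hjC _ hjx.
  have [jN|Nj|<-//] := ltngtP j N.
    case: xS; apply/(fsubsetP (fset_chain_sub Ssub jN)).
    by rewrite Sj in_fsetU [X in _ || X]xj orbT.
  case: xSj; apply/(fsubsetP (fset_chain_sub Ssub Nj)).
  by rewrite (hP N).2 in_fsetU xN orbT.
have : `|fsmeas (mu (h N).1) (B `&` [set` S N])| < e / 8.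
  apply: le_lt_trans hS; apply: le_trans (ler_norm_fsmeas _ _) _.
  by apply: le_fsmeas => // x [/BC].
have := lerB_normD (fsmeas (mu (h N).1) (h N).2) (fsmeas (mu (h N).1) (B `&` [set` S N])).
lra.
Qed.

End gliding_hump.

(** * Measures and clopen sets on the space N_F *)

Section NF_measures.
Variables (R : realType) (F : pfilter_on nat).
Implicit Types (mu : fsmeasure R (NF F)) (A : set (NF F)).

Definition NF_restr mu : fsmeasure R nat :=
  [fsfun n in [fset n in pmap (fun x : NF F => x : option nat) (finsupp mu)]%fset
    => mu (Some n)].

Lemma finsupp_NF_restr mu :
  [fset n in pmap (fun x : NF F => x : option nat) (finsupp mu)]%fset =i
  [pred n | (Some n : NF F) \in finsupp mu].
Proof.
move=> n; rewrite !inE /= mem_pmap.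
by apply/mapP/idP => [[x xmu ->//]|nmu]; exists (Some n).
Qed.

Lemma NF_restrE mu n : NF_restr mu n = mu (Some n).
Proof.
by rewrite fsfunE finsupp_NF_restr inE; case: finsuppP.
Qed.

Lemma NF_restr_fsabs mu : NF_restr (fsabs mu) = fsabs (NF_restr mu).
Proof. by apply/fsfunP => n; rewrite NF_restrE !fsabsE NF_restrE. Qed.

Lemma fsmeas_NF mu A :
  fsmeas mu A = (if None \in A then mu None else 0) +
                fsmeas (NF_restr mu) (Some @^-1` A).
Proof.
set D := [fset n in pmap (fun x : NF F => x : option nat) (finsupp mu)]%fset.
have sD : (finsupp mu `<=` (None : NF F) |` [fset (Some n : NF F) | n in D])%fset.
  apply/fsubsetP => -[n|] xmu; last exact: fset1U1.
  apply/fset1Ur/imfsetP; exists n => //=.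
  by rewrite finsupp_NF_restr.
rewrite (fsmeas_sum _ sD) big_mkcond big_fsetU1 /=; last first.
  by apply/imfsetP => -[].
rewrite big_imfset /=; last by move=> ? ? _ _ [].
rewrite fsmeas_fsfun -/D; congr (_ + _).
rewrite [RHS]big_mkcond; apply: eq_bigr => n _.
by congr (if _ then _ else _); apply/idP/idP; rewrite !inE.
Qed.

Lemma fsnorm_NF mu :
  fsnorm mu = `|mu None| + fsmeas (fsabs (NF_restr mu)) setT.
Proof. by rewrite fsnormE fsmeas_NF in_setT fsabsE NF_restr_fsabs. Qed.

(** The mass at [None] makes the total mass zero, so the value on a set containing p_F is minus the
    [nu]-mass of its complement. *)
Definition NF_balance (nu : fsmeasure R nat) : fsmeasure R (NF F) :=
  [fsfun x in ((None : NF F) |` [fset (Some n : NF F) | n in finsupp nu])%fset =>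
    if x is Some n then nu n else - fsmeas nu setT].

Lemma NF_balance_None nu : NF_balance nu None = - fsmeas nu setT.
Proof. by rewrite fsfunE fset1U1. Qed.

Lemma NF_restr_balance nu : NF_restr (NF_balance nu) = nu.
Proof.
apply/fsfunP => n; rewrite NF_restrE fsfunE in_fset1U /=.
case: ifPn => // /imfsetP nn; apply/esym/fsfun_dflt/negP => nnu.
by apply: nn; exists n.
Qed.

Lemma open_NF A : open A <-> (A None -> pfilter F (Some @^-1` A)).
Proof.
rewrite openE; split => [oA A0|oA [n|] Ax].
- by have /NF_nbhs_None[] := oA _ A0.
- exact/principal_filterP.
- by apply/NF_nbhs_None; split => //; exact: oA.
Qed.

(** Openness is a condition at [None] only, and exactly one of A and its complement contains
    [None]. *)
Lemma clopen_NF A : clopen A <->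
  if None \in A then pfilter F (Some @^-1` A) else pfilter F (~` (Some @^-1` A)).
Proof.
rewrite /clopen -openC !open_NF; have [A0|A0] := pselect (A None).
  rewrite mem_set//.
  by split=> [[/(_ A0)]|FA].
rewrite memNset//; by split=> [[_ /(_ A0)]|FA].
Qed.

End NF_measures.

(** * Density submeasures and restrictions of measures to finite sets *)

Section submeasure_lemmas.
Variable R : realType.

Lemma fset_nat_bounded (D : {fset nat}) : exists N, forall n, n \in D -> (n < N)%N.
Proof.
exists (\max_(n <- D) n).+1 => n nD; rewrite ltnS.
exact: (@leq_bigmax_seq _ _ predT id).
Qed.

Lemma cvge0P (u : nat -> \bar R) : (forall n, 0 <= u n)%E ->
  (u n @[n --> \oo] --> 0%E) <->
  (forall e, 0 < e -> \forall n \near \oo, (u n <= e%:E)%E).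
Proof.
move=> u0; split=> [/fine_cvgP[ufin ucvg] e e0|ule].
  move/cvgr0_norm_le: ucvg => /(_ e e0) uN.
  near=> n; rewrite -[u n]fineK; last by near: n.
  rewrite lee_fin; apply: le_trans (ler_norm _) _; near: n; exact: uN.
apply/fine_cvgP; split.
  have := ule 1 ltr01; apply: filterS => n un.
  by rewrite ge0_fin_numE// (le_lt_trans un)// ltry.
apply/cvgr0Pnorm_le => e e0; have := ule e e0; apply: filterS => n un /=.
rewrite ger0_norm ?fine_ge0// -lee_fin fineK//.
by rewrite ge0_fin_numE// (le_lt_trans un)// ltry.
Unshelve. all: by end_near. Qed.

Lemma fsmeasU_le (T : choiceType) (mu : fsmeasure R T) A B :
  (forall x, 0 <= mu x) -> fsmeas mu (A `|` B) <= fsmeas mu A + fsmeas mu B.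
Proof.
move=> mu0; rewrite (fsmeasID _ _ A) setIUl setIid setIC.
rewrite lerD// ?le_fsmeas//; first by move=> x [|[]].
by move=> x [[]].
Qed.

Lemma density_submeasure_sup (mu : nat -> fsmeasure R nat) :
  (forall n k, 0 <= mu n k) ->
  (forall n m, n != m -> [disjoint finsupp (mu n) & finsupp (mu m)]%fset) ->
  density_submeasure
    (fun A => ereal_sup [set (fsmeas (mu n) A)%:E | n in setT]).
Proof.
move=> mu0 dmu; split; last by exists mu; split.
split => [A||x|A B AB|A B].
- apply: le_ereal_sup_tmp; exists (fsmeas (mu 0%N) A)%:E; first by exists 0%N.
  by rewrite lee_fin fsmeas_ge0.
- rewrite -[RHS](@ereal_sup1 _ 0%E); congr ereal_sup.
  apply/seteqP; split=> [_ [n _ <-]|_ ->]; last exists 0%N => //.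
    by rewrite /fsmeas big_pred0// => x; rewrite in_set0.
  by rewrite /fsmeas big_pred0// => x; rewrite in_set0.
(* By disjointness at most one measure charges x, so the supremum on the singleton is finite. *)
- have [[n nx]|nx] := pselect (exists n, x \in finsupp (mu n)).
    apply: (@le_lt_trans _ _ (mu n x)%:E); last exact: ltry.
    apply/ereal_supP => _ [m _ <-]; rewrite fsmeas_set1 lee_fin.
    have [->//|mn] := eqVneq m n.
    rewrite [mu m x]fsfun_dflt//; apply/negP => mx.
    by have /fdisjointP/(_ _ mx)/negP := dmu _ _ mn.
  apply: (@le_lt_trans _ _ 0%E); last exact: ltry.
  apply/ereal_supP => _ [m _ <-]; rewrite fsmeas_set1 lee_fin.
  by rewrite fsfun_dflt//; apply/negP => mx; apply: nx; exists m.
- apply/ereal_supP => _ [m _ <-]; apply: le_ereal_sup_tmp.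
  by exists (fsmeas (mu m) B)%:E; [exists m | rewrite lee_fin le_fsmeas].
- apply/ereal_supP => _ [m _ <-].
  apply: (@le_trans _ _ ((fsmeas (mu m) A)%:E + (fsmeas (mu m) B)%:E)%E).
    by rewrite -EFinD lee_fin fsmeasU_le.
  by apply: leeD; apply: ereal_sup_ubound; exists m.
Qed.

(** A finite sum of scaled Dirac measures. It makes the measures defining a density submeasure
    admissible in [nonpathological]. *)
Lemma fsmeas_measure (mu : fsmeasure R nat) : (forall n, 0 <= mu n) ->
  exists m : {measure set nat -> \bar R}, forall A, m A = (fsmeas mu A)%:E.
Proof.
move=> mu0; have [N muN] := fset_nat_bounded (finsupp mu).
exists (msum (fun k => mscale (NngNum (mu0 k)) (dirac k)) N) => A.
have sN : (finsupp mu `<=` [fset k in iota 0 N])%fset.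
  by apply/fsubsetP => k /muN kN; rewrite !inE /= mem_iota.
rewrite /= (fsmeas_sum _ sN) /msum -sumEFin.
rewrite (perm_big (index_iota 0 N)) /=; last first.
  apply: uniq_perm; rewrite ?fset_uniq ?iota_uniq//.
  by move=> k; rewrite !inE /= /index_iota subn0.
rewrite [RHS]big_mkcond big_mkord; apply: eq_bigr => k _.
by rewrite /mscale /= diracE; case: ifP => _; rewrite ?mule1 ?mule0.
Qed.

(** Each [mu m] already attains its value on A at a finite initial segment, so [phi A] is the
    supremum of the values on these segments; by monotonicity that supremum is their limit. *)
Lemma density_lsc (mu : nat -> fsmeasure R nat) (phi : set nat -> \bar R) :
  (forall n k, 0 <= mu n k) ->
  (forall A, phi A = ereal_sup [set (fsmeas (mu n) A)%:E | n in setT]) ->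
  lsc_submeasure phi.
Proof.
move=> mu0 phiE A.
have phi_le B C : B `<=` C -> (phi B <= phi C)%E.
  move=> BC; rewrite !phiE; apply/ereal_supP => _ [m _ <-]; apply: le_ereal_sup_tmp.
  by exists (fsmeas (mu m) C)%:E; [exists m | rewrite lee_fin le_fsmeas].
have -> : phi A = ereal_sup (range (fun n => phi (A `&` `I_n.+1))).
  apply/eqP; rewrite eq_le; apply/andP; split; last first.
    by apply/ereal_supP => _ [n _ <-]; exact: phi_le.
  rewrite [leLHS]phiE; apply/ereal_supP => _ [m _ <-].
  have [N muN] := fset_nat_bounded (finsupp (mu m)).
  apply: le_ereal_sup_tmp; exists (phi (A `&` `I_N.+1)); first by exists N.
  rewrite phiE; apply: ereal_sup_ubound; exists m => //; congr EFin.
  apply: eq_fsmeas => x /muN xN; split=> [[]//|Ax]; split=> //=.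
  exact: ltnW.
apply: ereal_nondecreasing_cvgn => i j ij; apply: phi_le => x [Ax /= xi].
by split=> //=; exact: leq_trans xi _.
Qed.

Lemma density_nonpathological (mu : nat -> fsmeasure R nat) (phi : set nat -> \bar R) :
  (forall n k, 0 <= mu n k) ->
  (forall A, phi A = ereal_sup [set (fsmeas (mu n) A)%:E | n in setT]) ->
  nonpathological phi.
Proof.
move=> mu0 phiE A; apply/eqP; rewrite eq_le; apply/andP; split; last first.
  by apply/ereal_supP => _ [m mphi <-].
rewrite phiE; apply/ereal_supP => _ [n _ <-].
have [m mE] := fsmeas_measure (mu0 n).
rewrite -mE; apply: ereal_sup_ubound; exists m => // B.
by rewrite mE phiE; apply: ereal_sup_ubound; exists n.
Qed.

(** Additivity over the points of D. Finiteness of the point masses lets [fine] recover them without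
    loss. *)
Lemma measure_fset (m : {measure set nat -> \bar R}) (D : {fset nat}) A :
  (forall x, x \in D -> (m [set x] < +oo)%E) ->
  m (A `&` [set` D]) = (fsmeas [fsfun x in D => fine (m [set x])] A)%:E.
Proof.
move=> mfin; rewrite fsmeas_fsfun -sumEFin.
have -> : A `&` [set` D] = \bigcup_(x in [set` D]) (A `&` [set x]).
  by rewrite -setI_bigcupr; congr (_ `&` _); rewrite bigcup_imset1 image_id.
rewrite measure_fin_bigcup//; last first.
  by apply/trivIsetP => i j _ _ ij; rewrite setIACA setIid; rewrite set1I;
    case: ifPn; rewrite ?setI0// inE => /eqP; rewrite (negbTE ij).
rewrite fsbig_finite//= set_fsetK [RHS]big_mkcond big_seq [RHS]big_seq.
apply: eq_bigr => x xD; case: ifPn => [/set_mem|/negP] xA.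
  by rewrite setIidr ?fineK ?ge0_fin_numE ?mfin// => _ ->.
suff -> : A `&` [set x] = set0 by rewrite measure0.
by apply/seteqP; split=> // y [Ay yx]; apply: xA; rewrite -yx inE.
Qed.

End submeasure_lemmas.

(** * The three implications *)

Section implications.
Variables (R : realType) (F : pfilter_on nat).

Lemma cvg_fsmeas_NF_restr (mu : nat -> fsmeasure R (NF F)) (A B : set nat) :
  (forall C : set (NF F), clopen C -> fsmeas (mu n) C @[n --> \oo] --> (0 : R)) ->
  pfilter F A -> B `<=` ~` A ->
  fsmeas (NF_restr (mu n)) B @[n --> \oo] --> (0 : R).
Proof.
move=> mu0 FA BA; pose C : set (NF F) := [set x | if x is Some n then B n else False].
have C0 : None \notin C by rewrite memNset.
have : fsmeas (mu n) C @[n --> \oo] --> (0 : R).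
  apply: mu0; apply/clopen_NF; rewrite (negbTE C0).
  by apply: filterS FA => n An Cn; exact: BA An.
by under eq_fun do rewrite fsmeas_NF (negbTE C0) add0r.
Qed.

Lemma not_nikodym_density : free_filter F -> ~ nikodym_property R F ->
  exists phi : set nat -> \bar R,
    [/\ density_submeasure phi, phi setT = +oo%E &
        pfilter F `<=` dual_family (Exh phi)].
Proof.
move=> F_free /contrapT[mu [mu_infty mu0]]; pose nu n := NF_restr (mu n).
have nuF A : pfilter F A -> fsmeas (fsabs (nu n)) (~` A) @[n --> \oo] --> (0 : R).
  by move=> FA; apply: schur => B BA; exact: cvg_fsmeas_NF_restr BA.
(* Once the total mass of [mu n] is at most 1 in absolute value, the mass at p_F is at most 1 plus
   the variation of [nu n]. The norm is then at most 1 plus twice that variation, hence the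
   threshold 2 * r + 1. *)
have nu_infty (r : R) : \forall n \near \oo, r <= fsmeas (fsabs (nu n)) setT.
  have muT : fsmeas (mu n) setT @[n --> \oo] --> (0 : R) by exact/mu0/clopenT.
  move/cvgr0_norm_le : muT => /(_ 1 ltr01).
  move/cvgryPge : mu_infty => /(_ (2 * r + 1)); apply: filterS2 => n.
  rewrite fsnorm_NF fsmeas_NF in_setT -/(nu n) => hn.
  have := ler_norm_fsmeas (nu n) (Some @^-1` [set: NF F]).
  rewrite preimage_setT; have := lerB_normD (mu n None) (fsmeas (nu n) setT).
  lra.
(* A variation of at least i + 1 with at most 1 on the earlier supports leaves at least i for the
   new block. *)
have [|S [h hP]] := @fset_chain nat nat (fun n => finsupp (nu n))
  (fun i S n => [/\ (i <= n)%N, fsmeas (fsabs (nu n)) [set` S] <= 1 &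
                    i%:R + 1 <= fsmeas (fsabs (nu n)) setT]).
  move=> i S.
  (* Freeness of F enters here: it makes the variation on a finite set tend to 0. *)
  have FS : pfilter F (~` [set` S]) by apply: F_free; rewrite setCK.
  have /cvgr0_norm_le/(_ 1 ltr01) small := nuF _ FS.
  rewrite setCK in small.
  have : \forall n \near \oo, (i <= n)%N /\
      (`|fsmeas (fsabs (nu n)) [set` S]| <= 1 /\
       i%:R + 1 <= fsmeas (fsabs (nu n)) setT).
    exact: filterI (nbhs_infty_ge i) (filterI small (nu_infty _)).
  move=> /filter_ex[n [ni [+ nl]]]; rewrite ger0_norm ?fsmeas_ge0// => ns.
  by exists n.
have Ssub i : (S i `<=` S i.+1)%fset by rewrite (hP i).2 fsubsetUl.
pose lam i : fsmeasure R nat :=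
  [fsfun k in (finsupp (nu (h i)) `\` S i)%fset => `|nu (h i) k|].
have lam0 i k : 0 <= lam i k by rewrite fsfunE; case: ifP.
have lamE i A : fsmeas (lam i) A = fsmeas (fsabs (nu (h i))) (A `\` [set` S i]).
  rewrite fsmeas_fsfun fsmeas_fsabs big_mkcond [RHS]big_mkcond.
  rewrite -[RHS](big_fset_incl _ (fsubsetDl _ (S i))) => [|k kn].
    rewrite big_seq [RHS]big_seq; apply: eq_bigr => k.
    rewrite in_fsetD => /andP[kS _]; congr (if _ then _ else _).
    by rewrite in_setD mem_setE kS andbT.
  by rewrite in_fsetD kn andbT negbK in_setD mem_setE => ->; rewrite andbF.
exists (fun A => ereal_sup [set (fsmeas (lam n) A)%:E | n in setT]); split.
- apply: density_submeasure_sup => // i j.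
  wlog ij : i j / (i < j)%N.
    move=> wl; rewrite neq_ltn => /orP[ij|ji]; first by apply: wl; rewrite ?neq_ltn ij.
    by rewrite fdisjoint_sym; apply: wl; rewrite ?neq_ltn ji.
  move=> _; apply/fdisjointP => k /(fsubsetP (finsupp_sub _ _ _)).
  rewrite in_fsetD => /andP[_ kni].
  (* Block i lies inside [S i.+1], hence inside [S j], which block j avoids. *)
  have kSj : k \in S j.
    by apply: (fsubsetP (fset_chain_sub Ssub ij)); rewrite (hP i).2 in_fsetU kni orbT.
  by apply/negP => /(fsubsetP (finsupp_sub _ _ _)); rewrite in_fsetD kSj.
- apply/eqyP => r r0; have [i ri] : exists i : nat, r <= i%:R.
    by exists (Num.truncn r).+1; rewrite ltW// truncnS_gt.
  apply: le_ereal_sup_tmp; exists (fsmeas (lam i) setT)%:E; first by exists i.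
  have [[_ hS hl] _] := hP i.
  have := fsmeasID (fsabs (nu (h i))) setT [set` S i].
  by rewrite lee_fin lamE setTI; lra.
- move=> A FA; exists (~` A); last by rewrite setCK.
  apply/cvge0P => [n|e e0].
    apply: le_ereal_sup_tmp; eexists; first by exists 0%N.
    by rewrite lee_fin fsmeas_ge0.
  (* Blocks from N on have mass at most e off A. The earlier ones all lie in [S N], which is bounded
     by M, so a tail starting beyond M misses them. *)
  have /cvgr0_norm_le/(_ e e0)[N _ nuN] := nuF A FA.
  have [M SM] := fset_nat_bounded (S N).
  exists M => // n /= Mn; apply/ereal_supP => _ [i _ <-]; rewrite lee_fin.
  have [Ni|iN] := leqP N i.
    have [[ih _ _] _] := hP i; have := nuN (h i) (leq_trans Ni ih).
    rewrite /= ger0_norm ?fsmeas_ge0//; apply: le_trans.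
    by rewrite lamE; apply: le_fsmeas => // x [[]].
  rewrite (@eq_fsmeas _ _ _ _ set0) => [|k]; last first.
    move/(fsubsetP (finsupp_sub _ _ _)); rewrite in_fsetD => /andP[_ ki].
    split=> // -[_]; apply => /=; rewrite ltnS; apply: leq_trans Mn; apply/ltnW/SM.
    by apply: (fsubsetP (fset_chain_sub Ssub iN)); rewrite (hP i).2 in_fsetU ki orbT.
  by rewrite /fsmeas big_pred0 ?ltW// => x; rewrite in_set0.
Qed.

Lemma density_nonpathological_lsc :
  (exists phi : set nat -> \bar R,
    [/\ density_submeasure phi, phi setT = +oo%E &
        pfilter F `<=` dual_family (Exh phi)]) ->
  exists phi : set nat -> \bar R,
    [/\ submeasure phi, nonpathological phi, lsc_submeasure phi,
        phi setT = +oo%E & pfilter F `<=` dual_family (Exh phi)].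
Proof.
move=> [phi [[subphi [mu [mu0 _ phiE]]] phiT Fphi]]; exists phi; split => //.
- exact: density_nonpathological phiE.
- exact: density_lsc phiE.
Qed.

(** Subadditivity makes [phi] finite on initial segments, hence infinite on every tail. Lower
    semicontinuity then yields a finite window of the tail where [phi] exceeds r, and non-pathology
    a measure below [phi] with mass above r there; [nu] is its restriction to the window. *)
Lemma submeasure_large_mass (phi : set nat -> \bar R) (r : R) n :
  submeasure phi -> nonpathological phi -> lsc_submeasure phi ->
  phi setT = +oo%E ->
  exists nu : fsmeasure R nat, [/\ forall k, 0 <= nu k,
    r <= fsmeas nu setT &
    forall A, ((fsmeas nu A)%:E <= phi (A `\` `I_n.+1))%E].
Proof.
move=> [phi0 _ phi1 phi_le phiU] phi_np phi_lsc phiT.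
have phiI k : (phi `I_k < +oo)%E.
  elim: k => [|k IHk].
    by apply: le_lt_trans (phi1 0%N); apply: phi_le => x /=; rewrite ltn0.
  apply: (@le_lt_trans _ _ (phi `I_k + phi [set k])%E); last exact: lte_add_pinfty.
  apply: le_trans (phiU _ _); apply: phi_le => x /=.
  by rewrite ltnS leq_eqVlt => /orP[/eqP ->|]; [right|left].
have phiC : phi (~` `I_n.+1) = +oo%E.
  apply/eqP; rewrite -leye_eq leNgt; apply/negP => phiC.
  have := phiU `I_n.+1 (~` `I_n.+1); rewrite setUv phiT leye_eq => /eqP.
  by apply/eqP; rewrite lt_eqF// lte_add_pinfty.
have := phi_lsc (~` `I_n.+1); rewrite phiC => /cvgey_gt/(_ r)/filter_ex[k].
rewrite phi_np => /ereal_sup_gt[_ [m mphi <-]] rm.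
(* The window is the interval from n + 1 to k, empty if k is at most n. *)
pose D := [fset i in iota n.+1 (k.+1 - n.+1)]%fset.
have DE : [set` D] = ~` `I_n.+1 `&` `I_k.+1.
  apply/seteqP; split=> x /=; rewrite !inE /= mem_iota.
    by move=> /andP[nx xk]; split; [apply/negP; rewrite -leqNgt | lia].
  by move=> [/negP + xk]; rewrite -leqNgt => nx; lia.
have mfin x : x \in D -> (m [set x] < +oo)%E.
  by move=> _; exact: le_lt_trans (mphi _) (phi1 x).
exists [fsfun x in D => fine (m [set x])]; split=> [x||A].
- by rewrite fsfunE; case: ifP => // _; exact: fine_ge0.
- by rewrite -lee_fin -measure_fset// setTI DE ltW.
- rewrite -measure_fset// DE; apply: le_trans (mphi _) _; apply: phi_le.
  by move=> x [Ax [xn _]].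
Qed.

Lemma nonpathological_not_nikodym :
  (exists phi : set nat -> \bar R,
    [/\ submeasure phi, nonpathological phi, lsc_submeasure phi,
        phi setT = +oo%E & pfilter F `<=` dual_family (Exh phi)]) ->
  ~ nikodym_property R F.
Proof.
move=> [phi [subphi phi_np phi_lsc phiT Fphi]]; apply.
have [nu nuP] := choice (fun n => submeasure_large_mass n%:R n subphi phi_np phi_lsc phiT).
have [phi0 _ _ phi_le _] := subphi.
(* The complement of A is in [Exh phi], and the mass of B under [nu n] is at most the value of [phi]
   on the part of B beyond n. *)
have nu_cvg A B : pfilter F A -> B `<=` ~` A -> fsmeas (nu n) B @[n --> \oo] --> (0 : R).
  move=> /Fphi[X XE AX] BA.
  have /cvge0P cX := XE.
  apply/cvgr0Pnorm_le => e e0.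
  have := cX (fun n => phi0 _) e e0; apply: filterS => n.
  have [nu0 _ nuphi] := nuP n.
  rewrite ger0_norm ?fsmeas_ge0// -lee_fin; apply: le_trans.
  apply: le_trans (nuphi _) _; apply: phi_le => x [/BA]; rewrite -AX => Xx xn.
  by split=> //; apply: contrapT.
exists (fun n => NF_balance F (nu n)); split.
  apply/cvgryPge => r; near=> n.
  have [nu0 nun _] := nuP n.
  have : r <= n%:R by near: n; exact: nbhs_infty_ger.
  rewrite fsnorm_NF NF_balance_None NF_restr_balance normrN.
  have := ler_norm_fsmeas (nu n) setT.
  have := ler_norm (fsmeas (nu n) setT).
  have := normr_ge0 (fsmeas (nu n) setT).
  lra.
move=> A /clopen_NF; case: ifPn => A0 FA.
  (* With p_F in A the balancing mass cancels the mass inside A, leaving minus the mass of the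
     complement, to which [nu_cvg] applies. *)
  under eq_fun => n.
    rewrite fsmeas_NF A0 NF_balance_None NF_restr_balance.
    rewrite (fsmeasID (nu n) setT (Some @^-1` A)) setTI setTD opprD addrAC addNr add0r.
    over.
  rewrite -oppr0; apply: cvgN; exact: nu_cvg FA _.
under eq_fun do rewrite fsmeas_NF (negbTE A0) add0r NF_restr_balance.
by apply: nu_cvg FA _; rewrite setCK.
Unshelve. all: by end_near. Qed.

End implications.

Theorem mainTheorem2 (R : realType) (F : pfilter_on nat)
    (F_free : free_filter F) :
  [<-> ~ nikodym_property R F;
       exists phi : set nat -> \bar R,
         [/\ density_submeasure phi,
             phi setT = +oo%E &
             pfilter F `<=` dual_family (Exh phi)];
       exists phi : set nat -> \bar R,
         [/\ submeasure phi,
             nonpathological phi,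
             lsc_submeasure phi,
             phi setT = +oo%E &
             pfilter F `<=` dual_family (Exh phi)]].
Proof.
tfae; [exact: not_nikodym_density F_free | exact: density_nonpathological_lsc |].
exact: nonpathological_not_nikodym.
Qed.
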